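(* Let $\Omega\subset\mathbb R^d$ be a bounded open set and let $u_a,u_b\in L^2(\Omega)$ satisfy $u_a\le u_b$ almost everywhere on $\Omega$. Consider the box constraints $u_a\le u\le u_b$ a.e. on $\Omega$ for $u\in L^2(\Omega)$, written as $G(u)\in K$ with $G(u):=(u_b-u,\,u-u_a)$ and $K:=\{(y_1,y_2)\in L^2(\Omega)^2\mid y_1,y_2\ge0\text{ a.e. on }\Omega\}$ (and $C:=L^2(\Omega)$). Then every $\bar u\in L^2(\Omega)$ with $G(\bar u)\in K$ is sw-AKKT regular.
   Context: Here $X=L^2(\Omega)$ and $Y=L^2(\Omega)^2$, each identified with its dual space. For $u\in L^2(\Omega)$ and $r\ge0$ let $\mathcal M(u,r)$ be the set of all $\lambda_a-\lambda_b$ with $\lambda_a,\lambda_b\in L^2(\Omega)$, $\lambda_a,\lambda_b\le0$ a.e. on $\Omega$ and $$-\langle\lambda_b,u_b-u\rangle_{L^2(\Omega)}-\langle\lambda_a,u-u_a\rangle_{L^2(\Omega)}\le r$$ (this equals $\{G'(u)^*\lambda+\mu\mid\lambda\in Y^*,\ \mu\in\mathcal N_C(u),\ \langle\lambda,y-G(u)\rangle_Y\le r\ \forall y\in K\}$ in this setting, where $\mathcal N_C(u)=\{0\}$ because $C=X$). A point $\bar u$ with $G(\bar u)\in K$ is sw-AKKT regular if every $\bar v\in L^2(\Omega)$ for which there exist sequences $\{u^k\}\subset L^2(\Omega)$, $\{r^k\}\subset[0,+\infty)$, $\{v^k\}\subset L^2(\Omega)$ with $u^k\to\bar u$ strongly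 in $L^2(\Omega)$, $r^k\to0$, $v^k\rightharpoonup\bar v$ weakly in $L^2(\Omega)$ and $v^k\in\mathcal M(u^k,r^k)$ for all $k$ belongs to $\mathcal M(\bar u,0)$. *)

(* Defs.v *)
From HB Require Import structures.
From mathcomp Require Import all_boot all_order all_algebra.
From mathcomp Require Import all_classical all_reals all_analysis.

Set Implicit Arguments.
Unset Strict Implicit.
Unset Printing Implicit Defensive.
Import Order.TTheory GRing.Theory Num.Theory.
Import numFieldNormedType.Exports.
Local Open Scope classical_set_scope.
Local Open Scope ring_scope.

Section tuple_measure.
Context {disp : measure_display} {T : measurableType disp} {R : realType}.
Variable mu : {sigma_finite_measure set T -> \bar R}.

Section step.
Variables (n : nat) (m : {sigma_finite_measure set (n.-tuple T) -> \bar R}).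

Let consT (x : T * n.-tuple T) : n.+1.-tuple T := [tuple of x.1 :: x.2].

Let measurable_consT : measurable_fun [set: T * n.-tuple T] consT.
Proof. exact: measurable_cons. Qed.

Definition tuple_measure_step : set (n.+1.-tuple T) -> \bar R :=
  pushforward (mu \x m)%E consT.

Let unconsT (x : n.+1.-tuple T) : T * n.-tuple T :=
  (thead x, [tuple of behead x]).

Let measurable_unconsT : measurable_fun [set: n.+1.-tuple T] unconsT.
Proof.
apply/measurable_fun_pairP; split => /=.
  exact: measurable_tnth.
exact: measurable_behead.
Qed.

Let sigma_finite_step : sigma_finite setT tuple_measure_step.
Proof.
have /sigma_finiteP[F [FT ndF Foo]] := sigma_finiteT mu.
have /sigma_finiteP[G [GT ndG Goo]] := sigma_finiteT m.
exists (fun i => unconsT @^-1` (F i `*` G i)).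
  rewrite -preimage_bigcup (_ : \bigcup_i _ = setT) ?preimage_setT//.
  apply/seteqP; split => // -[x t] _.
  have [i _ Fx] : (\bigcup_i F i) x by rewrite -FT.
  have [j _ Gt] : (\bigcup_i G i) t by rewrite -GT.
  exists (maxn i j) => //; split => /=.
    by move: x Fx; exact/subsetPset/ndF/leq_maxl.
  by move: t Gt; exact/subsetPset/ndG/leq_maxr.
move=> i; have [mFi Fi] := Foo i; have [mGi Gi] := Goo i; split.
  rewrite -[X in measurable X]setTI; apply: measurable_unconsT => //.
  exact: measurableX.
rewrite /tuple_measure_step /pushforward -comp_preimage.
rewrite (_ : unconsT \o consT = id); last first.
  apply/funext => -[x t] /=; rewrite /unconsT /consT/=.
  by congr pair; apply/val_inj.
by rewrite preimage_id product_measure1E// lte_mul_pinfty// ge0_fin_numE.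
Qed.

Let step0 : tuple_measure_step set0 = 0%E.
Proof. exact: measure0. Qed.

Let step_ge0 A : (0 <= tuple_measure_step A)%E.
Proof. exact: measure_ge0. Qed.

Let step_sigma_additive : semi_sigma_additive tuple_measure_step.
Proof. exact: measure_semi_sigma_additive. Qed.

HB.instance Definition _ := isMeasure.Build _ _ _ tuple_measure_step
  step0 step_ge0 step_sigma_additive.
HB.instance Definition _ :=
  Measure_isSigmaFinite.Build _ _ _ tuple_measure_step sigma_finite_step.

End step.

(* The n-fold product measure on T^n.  The library provides the product
   sigma-algebra on n.-tuple T but only binary product measures. *)
Fixpoint tuple_measure (n : nat) :
    {sigma_finite_measure set (n.-tuple T) -> \bar R} :=
  if n is n'.+1 then tuple_measure_step (tuple_measure n') else \d_ [tuple].

Lemma tuple_measure_box n (A : 'I_n -> set T) : (forall i, measurable (A i)) ->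
  measurable [set t : n.-tuple T | forall i, A i (tnth t i)] /\
  tuple_measure n [set t | forall i, A i (tnth t i)] = (\prod_i mu (A i))%E.
Proof.
elim: n A => [|n IH] A mA.
  rewrite (_ : [set t | _] = setT); last by apply/seteqP; split => // t _ [].
  by split => //; rewrite /= diracT big_ord0.
have {IH} [mB BE] := IH _ (fun i => mA (lift ord0 i)).
split.
  rewrite (_ : [set t | _] =
      \bigcap_(i in [set: 'I_n.+1]) ((@tnth _ T ^~ i) @^-1` A i)).
    apply: fin_bigcap_measurable => // i _.
    by rewrite -[X in measurable X]setTI; exact: measurable_tnth.
  by apply/seteqP; split => t /= h i; [move=> _; exact: h|exact: h].
rewrite big_ord_recl /= -BE.
rewrite /tuple_measure_step /pushforward.
rewrite (_ : _ @^-1` _ = A ord0 `*`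
  [set t : n.-tuple T | forall i, A (lift ord0 i) (tnth t i)]).
  by rewrite product_measure1E.
apply/seteqP; split => [[x t]/= h|[x t]/= [h0 h] i].
  split; first by have := h ord0; rewrite tnth0.
  by move=> i; have := h (lift ord0 i); rewrite tnthS.
by case: (unliftP ord0 i) => [j ->|->]; rewrite ?tnth0 ?tnthS.
Qed.

End tuple_measure.

Section lebesgue_measure_Rd.
Context {R : realType} {d : nat}.
Local Notation T := (measurableTypeR R).

(* R^d with its usual topology ('rV[R]_d carries the sup norm, which has the same
   open and the same bounded sets as the Euclidean norm) and its Borel
   sigma-algebra.  Working with Borel instead of Lebesgue measurable functions
   does not change the classes modulo a.e. equality. *)
Definition Rd := g_sigma_algebraType (@open 'rV[R]_d).

Definition tuple_to_Rd (t : d.-tuple T) : Rd := \row_i tnth t i.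

Let measurable_tuple_to_Rd : measurable_fun setT tuple_to_Rd.
Proof.
have H := @measurability _ _ _ _ setT tuple_to_Rd (@open 'rV[R]_d).
apply: H => //.
move=> _ [U oU <-]; rewrite setTI.
pose box (q : 'rV[rat]_d * 'rV[rat]_d) : set 'rV[R]_d :=
  [set x | forall i, ratr (q.1 ord0 i) < x ord0 i < ratr (q.2 ord0 i)].
have -> : U = \bigcup_q (if pselect (box q `<=` U) then box q else set0).
  apply/seteqP; split => [x Ux|x [q _]]; last by case: pselect => // qU /qU.
  have [e /= e0 xeU] : exists2 e : R, 0 < e & ball x e `<=` U.
    by apply/nbhs_ballP; exact: open_nbhs_nbhs.
  have lo i : exists q : rat, (x ord0 i - e < ratr q < x ord0 i).
    have [|q] := @rat_in_itvoo _ (x ord0 i - e) (x ord0 i).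
      by rewrite ltrBlDr ltrDl.
    by rewrite in_itv; exists q.
  have hi i : exists q : rat, (x ord0 i < ratr q < x ord0 i + e).
    have [|q] := @rat_in_itvoo _ (x ord0 i) (x ord0 i + e).
      by rewrite ltrDl.
    by rewrite in_itv; exists q.
  exists (\row_i sval (cid (lo i)), \row_i sval (cid (hi i))) => //.
  case: pselect => [_ i|].
    rewrite !mxE/=.
    by case: cid => p /= /andP[_ ->]; case: cid => q /= /andP[-> _].
  move=> nU; exfalso; apply: nU => y /= xy; apply: xeU; split => // i j.
  rewrite ord1 -ball_normE/= ltr_distlC.
  have := xy j; rewrite !mxE.
  case: cid => p /= /andP[xp _]; case: cid => q /= /andP[_ qx] /andP[py yq].
  by rewrite (lt_trans xp py) (lt_trans yq qx).
rewrite preimage_bigcup.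
apply: countable_bigcupT_measurable => // q.
case: pselect => qU; last by rewrite preimage_set0.
have [+ _] := @tuple_measure_box _ T R lebesgue_measure d
  (fun i => `]ratr (q.1 ord0 i), ratr (q.2 ord0 i)[%classic) (fun=> measurable_itv _).
suff <- : tuple_to_Rd @^-1` box q =
    [set t | forall i, `]ratr (q.1 ord0 i), ratr (q.2 ord0 i)[%classic
                         (tnth t i)] by [].
apply/seteqP; split => t /= h i.
  by have := h i; rewrite /= in_itv/= /tuple_to_Rd !mxE.
by have := h i; rewrite /= in_itv/= /tuple_to_Rd !mxE.
Qed.

Definition lebesgue_Rd : set Rd -> \bar R :=
  pushforward (tuple_measure lebesgue_measure d) tuple_to_Rd.

Let lebesgue_Rd0 : lebesgue_Rd set0 = 0%E.
Proof. exact: measure0. Qed.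

Let lebesgue_Rd_ge0 A : (0 <= lebesgue_Rd A)%E.
Proof. exact: measure_ge0. Qed.

Let lebesgue_Rd_sigma_additive : semi_sigma_additive lebesgue_Rd.
Proof. exact: measure_semi_sigma_additive. Qed.

HB.instance Definition _ := isMeasure.Build _ _ _ lebesgue_Rd
  lebesgue_Rd0 lebesgue_Rd_ge0 lebesgue_Rd_sigma_additive.

(* The normalization that characterizes Lebesgue measure. *)
Lemma lebesgue_Rd_box (a b : 'rV[R]_d) : (forall i, a ord0 i <= b ord0 i) ->
  lebesgue_Rd [set x : 'rV[R]_d | forall i, a ord0 i <= x ord0 i <= b ord0 i] =
  (\prod_i (b ord0 i - a ord0 i))%:E.
Proof.
move=> ab; have [_] := @tuple_measure_box _ T R lebesgue_measure d
  (fun i => `[a ord0 i, b ord0 i]%classic) (fun=> measurable_itv _).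
rewrite /lebesgue_Rd /pushforward => mE.
rewrite (_ : _ @^-1` _ = [set t | forall i, `[a ord0 i, b ord0 i]%classic (tnth t i)]).
  rewrite mE -[RHS]prodEFin; apply: eq_bigr => i _.
  rewrite [LHS](@lebesgue_measure_itv R)/= lte_fin.
  have := ab i; rewrite le_eqVlt => /predU1P[->|->]; last by rewrite EFinN.
  by rewrite ltxx subrr.
by apply/seteqP; split => t /= h i; have := h i; rewrite /= in_itv/= /tuple_to_Rd !mxE.
Qed.

Lemma open_measurable_Rd (U : set 'rV[R]_d) : open U -> measurable (U : set Rd).
Proof. exact: sub_sigma_algebra. Qed.

(* Lebesgue measure restricted to Omega: a.e. properties and integrals for this
   measure are a.e. properties on Omega and integrals over Omega; the values of
   functions outside Omega are irrelevant. *)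
Definition lebesgue_on (Omega : set 'rV[R]_d) (oOmega : open Omega) :
    {measure set Rd -> \bar R} :=
  mrestr lebesgue_Rd (open_measurable_Rd oOmega).

End lebesgue_measure_Rd.
Arguments Rd : clear implicits.

Section box_constraints.
Context {disp : measure_display} {T : measurableType disp} {R : realType}.
Variable mu : {measure set T -> \bar R}.

(* Square-integrable functions.  The elements of L^2 are the classes of these
   modulo a.e. equality; every notion below is invariant under it. *)
Definition L2 := LfunType mu (lee1n 2).

Definition L2dot (f g : L2) : R := \int[mu]_x (f x * g x).
Definition L2norm (f : L2) : R := fine ('N[mu]_2%:E [EFin \o f]).
Definition strong_cvg (u : nat -> L2) (ubar : L2) :=
  L2norm (u k - ubar) @[k --> \oo] --> 0.
(* L^2 being identified with its dual, functionals are inner products. *)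
Definition weak_cvg (v : nat -> L2) (vbar : L2) :=
  forall phi : L2, L2dot (v k) phi @[k --> \oo] --> L2dot vbar phi.

Definition box_G (ua ub u : L2) : L2 * L2 := (ub - u, u - ua).
Definition box_K : set (L2 * L2)%type :=
  [set y : (L2 * L2)%type | {ae mu, forall x, 0 <= y.1 x} /\ {ae mu, forall x, 0 <= y.2 x}].

(* box_M ua ub u r is the set M(u, r) of all la - lb; the equality with la - lb
   holds in L^2, that is, a.e. *)
Definition box_M (ua ub u : L2) (r : R) : set L2 :=
  [set v | exists la lb : L2,
    [/\ {ae mu, forall x, la x <= 0},
        {ae mu, forall x, lb x <= 0},
        - L2dot lb (ub - u) - L2dot la (u - ua) <= r &
        {ae mu, forall x, v x = (la - lb) x}]].

Definition sw_AKKT_regular (ua ub ubar : L2) : Prop :=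
  forall vbar : L2,
    (exists (u : nat -> L2) (r : nat -> R) (v : nat -> L2),
      [/\ strong_cvg u ubar,
          (forall k, 0 <= r k),
          r k @[k --> \oo] --> 0,
          weak_cvg v vbar &
          forall k, box_M ua ub (u k) (r k) (v k)]) ->
    box_M ua ub ubar 0 vbar.

End box_constraints.

(* Main.v *)
(** Membership of v in M(u, r) yields the variational inequality
    <v, w - u> <= r for every w in the box.  It survives the limit: weakly
    convergent sequences are norm bounded, so <v^k, u^k - ubar> tends to 0 and
    <vbar, w - ubar> <= 0 for every w in the box.  Taking w = ub where vbar > 0,
    w = ua where vbar < 0 and w = ubar elsewhere gives the complementarity
    inequality for la = min(vbar, 0) and lb = - max(vbar, 0).

    The norm boundedness is the uniform boundedness principle.  It is obtained
    from the convergence of normally convergent series in L^2, applied to a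
    point built by steps of size 3^-n that are chosen one after the other. *)

Require Import Defs.
From mathcomp Require Import all_boot all_order all_algebra.
From mathcomp Require Import all_classical all_reals all_analysis.
From mathcomp Require Import ring lra measurable_realfun.
Import Order.TTheory GRing.Theory Num.Theory.
Import numFieldNormedType.Exports.
Local Open Scope classical_set_scope.
Local Open Scope ring_scope.

Section L2_space.
Context {disp : measure_display} {T : measurableType disp} {R : realType}.
Variable mu : {measure set T -> \bar R}.
Local Notation L2 := (L2 mu).
Implicit Types f g h : L2.

(** * Inner product and norm of L^2 *)

Lemma measurable_L2 f : measurable_fun setT (f : T -> R).
Proof. by []. Qed.

Lemma integrable_L2dot f g : mu.-integrable setT (EFin \o (fun x => f x * g x)).
Proof. exact/Lfun1_integrable/Lfun2_mul_Lfun1/LfunP/LfunP. Qed.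

Lemma L2dotC f g : L2dot f g = L2dot g f.
Proof. by apply: eq_Rintegral => x _; rewrite mulrC. Qed.

Lemma L2dotDl f g h : L2dot (f + g) h = L2dot f h + L2dot g h.
Proof.
rewrite /L2dot -RintegralD//; [|exact: integrable_L2dot..].
by apply: eq_Rintegral => x _; rewrite -mulrDl.
Qed.

Lemma L2dotZl a f g : L2dot (a *: f) g = a * L2dot f g.
Proof.
rewrite /L2dot -RintegralZl//; last exact: integrable_L2dot.
by apply: eq_Rintegral => x _; rewrite mulrA.
Qed.

Lemma L2dotNl f g : L2dot (- f) g = - L2dot f g.
Proof. by rewrite -scaleN1r L2dotZl mulN1r. Qed.

Lemma L2dotBl f g h : L2dot (f - g) h = L2dot f h - L2dot g h.
Proof. by rewrite L2dotDl L2dotNl. Qed.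

Lemma L2dotDr f g h : L2dot f (g + h) = L2dot f g + L2dot f h.
Proof. by rewrite L2dotC L2dotDl !(L2dotC f). Qed.

Lemma L2dotNr f g : L2dot f (- g) = - L2dot f g.
Proof. by rewrite L2dotC L2dotNl L2dotC. Qed.

Lemma L2dotBr f g h : L2dot f (g - h) = L2dot f g - L2dot f h.
Proof. by rewrite L2dotDr L2dotNr. Qed.

Lemma L2dotZr a f g : L2dot f (a *: g) = a * L2dot f g.
Proof. by rewrite L2dotC L2dotZl L2dotC. Qed.

Lemma ae_eq_L2dotl f g h : {ae mu, forall x, f x = g x} ->
  L2dot f h = L2dot g h.
Proof.
move=> fg; rewrite /L2dot /Rintegral; congr fine.
apply: ae_eq_integral => //.
- exact: (measurable_int _ (integrable_L2dot f h)).
- exact: (measurable_int _ (integrable_L2dot g h)).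
- by apply: filterS fg => x fgx _ /=; rewrite fgx.
Qed.

Lemma L2dot_le0 f g : {ae mu, forall x, f x <= 0} ->
  {ae mu, forall x, 0 <= g x} -> L2dot f g <= 0.
Proof.
move=> f0 g0; rewrite -oppr_ge0 -L2dotNl /L2dot /Rintegral.
pose h x := (- f) x * g x; rewrite -[X in fine X]/(\int[mu]_x (h x)%:E)%E.
have ih : mu.-integrable setT (EFin \o h) by exact: integrable_L2dot.
(* The sign of [h] is known only a.e.; [|h|] has the same integral and is nonnegative everywhere. *)
rewrite (ae_eq_integral (fun x => `|h x|%:E))//.
- by apply: fine_ge0; apply: integral_ge0 => x _; rewrite lee_fin.
- exact: measurable_int ih.
- by apply/measurable_EFinP; apply: measurableT_comp => //;
    apply/measurable_EFinP; exact: measurable_int ih.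
- apply: filterS2 f0 g0 => x fx gx _ /=.
  by rewrite ger0_norm// mulr_ge0//= oppr_ge0.
Qed.

Lemma L2norm_ge0 f : 0 <= L2norm f.
Proof. exact/fine_ge0/Lnorm_ge0. Qed.

(** Kept in the extended reals, so that it also yields finiteness of the integral. *)
Lemma L2norm_sqrE f : (\int[mu]_x (f x ^+ 2)%:E)%E = (L2norm f ^+ 2)%:E.
Proof.
have := powR_Lnorm mu (EFin \o f) (_ : 2%:R != 0 :> R).
rewrite -finite_norm_fine => /(_ _)/esym.
under eq_integral do rewrite /= powR_mulrn// -normrX ger0_norm ?sqr_ge0//.
by move=> ->//; rewrite ?pnatr_eq0// poweR_EFin powR_mulrn// L2norm_ge0.
Qed.

Lemma L2dotff f : L2dot f f = L2norm f ^+ 2.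
Proof. by rewrite /L2dot /Rintegral -[RHS]/(fine (_ %:E)) -L2norm_sqrE. Qed.

Lemma L2normD f g : L2norm (f + g) <= L2norm f + L2norm g.
Proof. exact: ler_LnormD. Qed.

Lemma L2normZ a f : L2norm (a *: f) = `|a| * L2norm f.
Proof.
apply: EFin_inj; rewrite EFinM !finite_norm_fine.
exact: LnormZ.
Qed.

Lemma L2norm0 : L2norm (0 : L2) = 0.
Proof. by rewrite -(scale0r (0 : L2)) L2normZ normr0 mul0r. Qed.

Lemma L2norm_sum (F : nat -> L2) m n :
  L2norm (\sum_(m <= i < n) F i) <= \sum_(m <= i < n) L2norm (F i).
Proof.
elim/big_rec2: _ => [|i a f _ h]; first by rewrite L2norm0.
by apply: le_trans (L2normD _ _) _; rewrite lerD2l.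
Qed.

Lemma Cauchy_Schwarz f g : `|L2dot f g| <= L2norm f * L2norm g.
Proof.
apply: le_trans (le_normr_Rintegral _ (integrable_L2dot f g)) _ => //.
rewrite -lee_fin EFinM !finite_norm_fine.
apply: le_trans (hoelder mu (measurable_L2 f) (measurable_L2 g) _ _ _); last 3 first.
- by [].
- by [].
- by rewrite [RHS]splitr !div1r.
rewrite Lnorm1 /Rintegral fineK//.
apply: integrable_fin_num => //; exact/integrable_norm/integrable_L2dot.
Qed.

(** * Membership in L^2 and Fatou's lemma *)

Lemma Lfun2P (F : T -> R) : measurable_fun setT F ->
  (\int[mu]_x (F x ^+ 2)%:E < +oo)%E -> F \in Lfun mu 2%:E.
Proof.
move=> mF Foo; apply/andP; rewrite !inE; split => //=.
rewrite /finite_norm unlock poweR_lty//=.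
by under eq_integral do rewrite powR_mulrn// -normrX ger0_norm ?sqr_ge0//.
Qed.

Lemma Lfun2_le (F : T -> R) g : measurable_fun setT F ->
  (forall x, `|F x| <= `|g x|) -> F \in Lfun mu 2%:E.
Proof.
move=> mF Fg; apply: Lfun2P => //.
apply: le_lt_trans (_ : \int[mu]_x (g x ^+ 2)%:E < _)%E.
  apply: ge0_le_integral => //.
  - by move=> x _; rewrite lee_fin sqr_ge0.
  - by apply/measurable_EFinP; exact: measurable_funX.
  - by apply/measurable_EFinP; exact: measurable_funX.
  - move=> x _; rewrite lee_fin -[F x ^+ 2]real_normK ?num_real//.
    by rewrite -[g x ^+ 2]real_normK ?num_real// lerXn2r ?nnegrE.
by rewrite L2norm_sqrE ltry.
Qed.

Lemma measurable_limn_einf (F : nat -> T -> \bar R) :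
  (forall n, measurable_fun setT (F n)) ->
  measurable_fun setT (fun x => limn_einf (F ^~ x)).
Proof.
move=> mF.
rewrite (_ : (fun x => _) = (fun x => - limn_esup (fun n => - F n x))%E).
  apply: measurableT_comp => //; apply: measurable_fun_limn_esup => n.
  exact: measurableT_comp.
apply/funext => x; rewrite -limn_einfN; congr limn_einf.
by apply/funext => n /=; rewrite oppeK.
Qed.

Lemma limn_einf_le (u : (\bar R)^nat) c : (forall n, (u n <= c)%E) -> (limn_einf u <= c)%E.
Proof.
move=> uc; rewrite limn_einf_lim; apply: lime_le; first exact: is_cvg_einfs.
by apply: nearW => n; apply: le_trans (uc n); apply: ereal_inf_lbound; exists n => /=.
Qed.

(** Fatou's lemma for squares. [F] is a bare function, so the bound serves both to place [F] in L^2
    and to estimate its norm. *)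
Lemma L2_fatou (H : nat -> L2) (F : T -> R) C :
  measurable_fun setT F -> {ae mu, forall x, H n x @[n --> \oo] --> F x} ->
  (forall n, L2norm (H n) <= C) -> (\int[mu]_x (F x ^+ 2)%:E <= (C ^+ 2)%:E)%E.
Proof.
move=> mF HF HC.
have mH n : measurable_fun setT (fun x => (H n x ^+ 2)%:E).
  by apply/measurable_EFinP; exact: measurable_funX.
apply: (@le_trans _ _ (\int[mu]_x limn_einf (fun n => (H n x ^+ 2)%:E))%E).
  apply: ae_ge0_le_integral => //.
  - by move=> x _; rewrite lee_fin sqr_ge0.
  - by apply/measurable_EFinP; exact: measurable_funX.
  - move=> x _; rewrite limn_einf_lim; apply: lime_ge; first exact: is_cvg_einfs.
    apply: nearW => n; apply: le_ereal_inf_tmp => _ [m _ <-].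
    by rewrite lee_fin sqr_ge0.
  - exact: measurable_limn_einf.
  - apply: filterS HF => x HFx _.
    have [|-> _//] := @cvg_limn_einf_sup _ (fun n => (H n x ^+ 2)%:E) (F x ^+ 2)%:E.
    by apply: cvg_EFin; [exact: nearW | exact: cvgM].
apply: le_trans (fatou mu measurableT mH _) _.
  by move=> n x _; rewrite lee_fin sqr_ge0.
apply: limn_einf_le => n; rewrite L2norm_sqrE lee_fin lerXn2r ?nnegrE//.
  exact: L2norm_ge0.
exact: le_trans (L2norm_ge0 _) (HC n).
Qed.

(** * Normally convergent series in L^2 *)

Lemma L2_sumE (f : nat -> L2) m n x :
  (\sum_(m <= i < n) f i) x = \sum_(m <= i < n) f i x.
Proof. by elim/big_rec2: _ => // i y g _ <-. Qed.

Lemma L2_abs f : exists2 g : L2, (forall x, g x = `|f x|) & L2norm g = L2norm f.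
Proof.
have absf : (fun x => `|f x|) \in Lfun mu 2%:E.
  by apply: (Lfun2_le _ f) => [|x]; [exact: measurableT_comp|rewrite normr_id].
exists (Lfun_Sub (lee1n 2) absf) => //.
apply/eqP; rewrite -(eqrXn2 (n := 2))// ?L2norm_ge0//; apply/eqP/EFin_inj.
rewrite -!L2norm_sqrE; apply: eq_integral => x _ /=.
by rewrite real_normK ?num_real.
Qed.

(** The partial sums of the [|f i|] increase and have norms at most [B]. By Fatou the liminf of
    their squares is integrable, hence finite a.e., which gives absolute convergence. *)
Lemma ae_cvg_series_L2 (f : nat -> L2) B :
  (forall n, \sum_(0 <= i < n) L2norm (f i) <= B) ->
  {ae mu, forall x, cvgn (series (fun i => f i x))}.
Proof.
move=> fB.
have /choice[g gE] : forall i, exists g : L2,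
    (forall x, g x = `|f i x|) /\ L2norm g = L2norm (f i).
  by move=> i; have [g gf gn] := L2_abs (f i); exists g.
pose G n := \sum_(0 <= i < n) g i.
have GE n x : G n x = \sum_(0 <= i < n) `|f i x|.
  by rewrite L2_sumE; apply: eq_bigr => i _; case: (gE i) => ->.
have GB n : L2norm (G n) <= B.
  apply: le_trans (L2norm_sum _ _ _) _; apply: le_trans (fB n).
  by apply: ler_sum => i _; case: (gE i) => _ ->.
pose h x := limn_einf (fun n => (G n x ^+ 2)%:E).
have mG n : measurable_fun setT (fun x => (G n x ^+ 2)%:E).
  by apply/measurable_EFinP; exact: measurable_funX.
have mh : measurable_fun setT h by exact: measurable_limn_einf.
have h0 x : (0 <= h x)%E.
  rewrite /h limn_einf_lim; apply: lime_ge; first exact: is_cvg_einfs.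
  apply: nearW => n; apply: le_ereal_inf_tmp => _ [m _ <-].
  by rewrite lee_fin sqr_ge0.
have ih : mu.-integrable setT h.
  apply/integrableP; split => //.
  under eq_integral do rewrite gee0_abs//.
  apply: le_lt_trans (ltry (B ^+ 2)).
  apply: le_trans (fatou mu measurableT mG _) _.
    by move=> n x _; rewrite lee_fin sqr_ge0.
  apply: limn_einf_le => n; rewrite L2norm_sqrE lee_fin lerXn2r ?nnegrE//.
    exact: L2norm_ge0.
  exact: le_trans (L2norm_ge0 _) (GB n).
apply: filterS (integrable_ae measurableT ih) => x /(_ I) hx.
have ndG : nondecreasing_seq (fun n => (G n x ^+ 2)%:E).
  move=> m n mn; rewrite lee_fin lerXn2r ?nnegrE ?GE ?sumr_ge0//.
  exact: (@nondecreasing_series _ (fun i => `|f i x|) xpredT).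
have Gh n : G n x ^+ 2 <= fine (h x).
  have [hE _] := cvg_limn_einf_sup (ereal_nondecreasing_cvgn ndG).
  by rewrite -lee_fin fineK// /h hE; apply: ereal_sup_ubound; exists n.
apply: normed_cvg; apply: nondecreasing_is_cvgn.
  exact: (@nondecreasing_series _ (fun i => `|f i x|) xpredT).
(* From [s^2 <= fine (h x)] and [2 s <= s^2 + 1], avoiding square roots. *)
exists (fine (h x) + 1) => _ [n _ <-].
have := Gh n; rewrite GE; rewrite /series /=; set s := (\sum_(_ <= _ < _) _) => sh; rewrite -[leLHS]/s. have := sqr_ge0 (s - 1); nra.
Qed.

(** Convergence takes the form of an explicit error: any bound on the tail sums of norms bounds the
    distance from [F] to the partial sum. *)
Lemma L2_series_cvg (f : nat -> L2) B :
  (forall n, \sum_(0 <= i < n) L2norm (f i) <= B) ->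
  exists F : L2, forall n C,
    (forall m, \sum_(n <= i < n + m) L2norm (f i) <= C) ->
    L2norm (F - \sum_(0 <= i < n) f i) <= C.
Proof.
move=> fB.
(* The limsup is measurable and defined at every point; it is the sum of the series wherever that
   converges. *)
pose F x := fine (limn_esup (fun n => (\sum_(0 <= i < n) f i x)%:E)).
have mF : measurable_fun setT F.
  apply: measurableT_comp => //; apply: measurable_fun_limn_esup => n.
  by apply/measurable_EFinP; exact: measurable_sum.
have SF : {ae mu, forall x, \sum_(0 <= i < n) f i x @[n --> \oo] --> F x}.
  apply: filterS (ae_cvg_series_L2 _ _ fB) => x cx.
  rewrite /F; have [|_ ->//] := @cvg_limn_einf_sup _
    (fun n => (\sum_(0 <= i < n) f i x)%:E) (limn (series (fun i => f i x)))%:E.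
  by apply: cvg_EFin; [exact: nearW|exact: cx].
have fatouF n C : (forall m, \sum_(n <= i < n + m) L2norm (f i) <= C) ->
    (\int[mu]_x ((F x - (\sum_(0 <= i < n) f i) x) ^+ 2)%:E <= (C ^+ 2)%:E)%E.
  (* For fixed [n], the blocks from [n] to [n + m] tend a.e. to [F] minus the partial sum as [m]
     grows. *)
  move=> fC; apply: (@L2_fatou (fun m => \sum_(n <= i < n + m) f i)).
  - by apply: measurable_funB.
  - apply: filterS SF => x SFx.
    rewrite (_ : (fun m => _) = (fun m => (\sum_(0 <= i < n + m) f i x)
                                  - (\sum_(0 <= i < n) f i) x)).
      apply: cvgB; last exact: cvg_cst.
      move: SFx; rewrite -(cvg_shiftn n) => SFx; under eq_fun do rewrite addnC.
      exact: SFx.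
    apply/funext => m; rewrite !L2_sumE (big_cat_nat (m := 0) (n := n) (p := n + m))//=.
      by rewrite addrAC subrr add0r.
    by rewrite leq_addr.
  - by move=> m; exact: le_trans (L2norm_sum _ _ _) (fC m).
have FL : F \in Lfun mu 2%:E.
  apply: Lfun2P => //; apply: le_lt_trans (ltry (B ^+ 2)).
  have := fatouF 0%N B; rewrite big_geq//; under eq_integral do rewrite subr0.
  by apply => m; rewrite add0n.
exists (Lfun_Sub (lee1n 2) FL) => n C fC.
(* The empty block [m = 0] gives the sign of [C], needed to compare squares. *)
have C0 : 0 <= C by have := fC 0%N; rewrite addn0 big_geq.
rewrite -(ler_pXn2r (n := 2)) ?nnegrE ?L2norm_ge0// -lee_fin -L2norm_sqrE.
exact: fatouF.
Qed.

(** * Uniform boundedness principle *)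

Lemma expn3V_gt0 n : 0 < 3^-1 ^+ n :> R.
Proof. by rewrite exprn_gt0// invr_gt0. Qed.

Lemma sum_expn3V n m : \sum_(n <= i < n + m) 3^-1 ^+ i <= 3^-1 ^+ n * (3 / 2) :> R.
Proof.
suff -> : \sum_(n <= i < n + m) 3^-1 ^+ i =
    (3^-1 ^+ n - 3^-1 ^+ (n + m)) * (3 / 2) :> R.
  by rewrite ler_pM2r ?divr_gt0// lerBlDr lerDl ltW// expn3V_gt0.
elim: m => [|m IH]; first by rewrite addn0 big_geq// subrr mul0r.
by rewrite addnS big_nat_recr ?leq_addr//= IH exprSr; field.
Qed.

(* One step of Sokal's proof of the uniform boundedness principle: moving x by
   a in the direction of t, with the sign of <t, x>, brings <t, _> to size at
   least a |t|. *)
Lemma L2_push (t x : L2) (a : R) : 0 <= a ->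
  exists2 y : L2, L2norm (y - x) <= a & a * L2norm t <= `|L2dot t y|.
Proof.
move=> a0; have [t0|t0] := eqVneq (L2norm t) 0.
  by exists x; rewrite ?subrr ?L2norm0// t0 mulr0.
pose s : R := if 0 <= L2dot t x then 1 else -1.
have s1 : `|s| = 1 by rewrite /s; case: ifP; rewrite ?normrN normr1.
exists (x + (s * a / L2norm t) *: t).
  rewrite addrAC subrr add0r L2normZ !normrM s1 mul1r normfV.
  by rewrite (ger0_norm a0) (ger0_norm (L2norm_ge0 t)) mulfVK.
rewrite L2dotDr L2dotZr L2dotff.
have -> : s * a / L2norm t * L2norm t ^+ 2 = s * (a * L2norm t) by field.
have b0 : 0 <= a * L2norm t by rewrite mulr_ge0// L2norm_ge0.
rewrite /s; case: (lerP 0 (L2dot t x)) => tx.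
  by rewrite mul1r ger0_norm ?addr_ge0// lerDr.
by rewrite mulN1r ler0_norm; lra.
Qed.

(** If the norms were unbounded, some [t n] among the [v k] would satisfy [3^-n |t n| > 2 n]. The
    n-th step makes [|<t n, x n.+1>|] at least [3^-n |t n|]; the later steps can undo at most half
    of this, so [|<t n, F>| >= n] for every [n]. *)
Lemma weakly_bounded_norm_bounded (v : nat -> L2) :
  (forall phi, exists M, forall k, `|L2dot (v k) phi| <= M) ->
  exists C, forall k, L2norm (v k) <= C.
Proof.
move=> vb; apply: contrapT => nb.
have /choice[t tE] : forall n : nat, exists t : L2,
    (exists k, t = v k) /\ 2 * n%:R < 3^-1 ^+ n * L2norm t.
  move=> n; apply: contrapT => nt; apply: nb; exists (2 * n%:R / 3^-1 ^+ n) => k.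
  rewrite leNgt; apply/negP => h; apply: nt; exists (v k); split; first by exists k.
  by rewrite [ltRHS]mulrC -ltr_pdivrMr ?expn3V_gt0.
(* Choosing over all pairs of index and current point at once lets the sequence be a plain
   recursion. *)
have /choice[p pE] : forall nx : nat * L2, exists y : L2,
    L2norm (y - nx.2) <= 3^-1 ^+ nx.1 /\
    3^-1 ^+ nx.1 * L2norm (t nx.1) <= `|L2dot (t nx.1) y|.
  move=> [n x] /=.
  have [y y1 y2] := L2_push (t n) x (3^-1 ^+ n) (ltW (expn3V_gt0 n)).
  by exists y.
pose x := fix x n : L2 := if n is n'.+1 then p (n', x n') else 0.
have xf n : \sum_(0 <= i < n) (x i.+1 - x i) = x n.
  by rewrite telescope_sumr// subr0.
have normf i : L2norm (x i.+1 - x i) <= 3^-1 ^+ i by have [] := pE (i, x i).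
have fsum n m : \sum_(n <= i < n + m) L2norm (x i.+1 - x i) <= 3^-1 ^+ n * (3 / 2).
  by apply: le_trans (sum_expn3V n m); apply: ler_sum => i _; exact: normf.
have [|F FE] := L2_series_cvg (fun i => x i.+1 - x i) (3 / 2).
  by move=> n; have := fsum 0%N n; rewrite add0n expr0 mul1r.
have [M vM] := vb F.
have tF n : n%:R <= M.
  have [[k tk] tn] := tE n.
  have [_ /= tx] := pE (n, x n).
  (* The tail from [n.+1] on is at most [3^-(n+1) * 3/2 = 3^-n / 2]. *)
  have := FE n.+1 _ (fsum n.+1); rewrite xf => Fx.
  have Fsplit : L2dot (t n) F = L2dot (t n) (x n.+1) + L2dot (t n) (F - x n.+1).
    by rewrite -L2dotDr addrC subrK.
  apply: le_trans (vM k); rewrite -tk Fsplit; apply: le_trans (lerB_normD _ _).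
  have := Cauchy_Schwarz (t n) (F - x n.+1).
  have : L2norm (t n) * L2norm (F - x n.+1) <= L2norm (t n) * (3^-1 ^+ n / 2).
    rewrite ler_wpM2l ?L2norm_ge0//; apply: le_trans Fx _.
    by rewrite exprS; lra.
  move: tx tn; rewrite -[x n.+1]/(p (n, x n)); nra.
have := tF (Num.bound M); rewrite leNgt archi_boundP//.
exact: le_trans (tF 0%N).
Qed.

(** * Pairing weak with strong convergence *)

Lemma weak_cvg_bounded (v : nat -> L2) (vbar : L2) : weak_cvg v vbar ->
  exists C, forall k, L2norm (v k) <= C.
Proof.
move=> vv; apply: weakly_bounded_norm_bounded => phi.
have /cvgP/cvg_seq_bounded := vv phi.
move=> [M [_ MP]]; exists (M + 1) => k; apply: MP => //; by rewrite ltrDl.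
Qed.

Lemma weak_strong_cvg0 (u v : nat -> L2) (ubar vbar : L2) :
  strong_cvg u ubar -> weak_cvg v vbar ->
  L2dot (v k) (u k - ubar) @[k --> \oo] --> 0.
Proof.
move=> uu /weak_cvg_bounded[C vC].
apply/norm_cvg0P.
apply: (@squeeze_cvgr _ _ _ _ (fun=> 0) (fun k => C * L2norm (u k - ubar))).
- apply: nearW => k; rewrite normr_ge0/=.
  by apply: le_trans (Cauchy_Schwarz _ _) _; rewrite ler_wpM2r ?L2norm_ge0.
- exact: cvg_cst.
- by rewrite -(mulr0 C); apply: cvgM; [exact: cvg_cst|exact: uu].
Qed.

(** * Variational inequality and regularity *)

(** Write [w - u] as [(w - ua) - (u - ua)] against [la] and as [(ub - u) - (ub - w)] against [lb]:
    the terms with [w] are nonpositive, the others sum to at most [r]. *)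
Lemma box_M_dot_le (ua ub u v w : L2) (r : R) :
  {ae mu, forall x, ua x <= w x <= ub x} -> box_M ua ub u r v ->
  L2dot v (w - u) <= r.
Proof.
move=> wab [la [lb [la0 lb0 lr vE]]].
rewrite (ae_eq_L2dotl _ _ _ vE).
have hla : L2dot la (w - ua) <= 0.
  by apply: L2dot_le0 => //; apply: filterS wab => x /andP[h _]; rewrite /= subr_ge0.
have hlb : L2dot lb (ub - w) <= 0.
  by apply: L2dot_le0 => //; apply: filterS wab => x /andP[_ h]; rewrite /= subr_ge0.
move: lr hla hlb; rewrite !(L2dotBl, L2dotBr); lra.
Qed.

Lemma box_sw_AKKT_regular (ua ub ubar : L2) :
  box_K (box_G ua ub ubar) -> sw_AKKT_regular ua ub ubar.
Proof.
move=> [/= ubP uaP] vbar [u [r [v [uu r0 rr vv vM]]]].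
pose la x := Num.min (vbar x) 0.
pose lb x := - Num.max (vbar x) 0.
have laL : la \in Lfun mu 2%:E.
  apply: (Lfun2_le _ vbar) => [|x]; first exact: measurable_minr.
  by rewrite /la; case: (lerP (vbar x) 0) => ?; rewrite ?normr0.
have lbL : lb \in Lfun mu 2%:E.
  apply: (Lfun2_le _ vbar) => [|x].
    by apply: measurableT_comp => //; exact: measurable_maxr.
  by rewrite /lb normrN; case: (lerP (vbar x) 0) => ?; rewrite ?normr0.
(* ubar + phi is feasible, and <vbar, phi> is the left-hand side of the
   complementarity inequality for (la, lb). *)
pose phi x := if 0 < vbar x then ub x - ubar x else
  if vbar x < 0 then ua x - ubar x else 0.
(* [gb + ga] dominates [phi] in each of its three cases. *)
have [gb gbE _] := L2_abs (ub - ubar).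
have [ga gaE _] := L2_abs (ua - ubar).
have phiL : phi \in Lfun mu 2%:E.
  apply: (Lfun2_le _ (gb + ga)) => [|x].
    apply: measurable_fun_ifT => //.
    - exact: measurable_fun_ltr.
    - exact: measurable_funB.
    - apply: measurable_fun_ifT => //; first exact: measurable_fun_ltr.
      exact: measurable_funB.
  rewrite -[(gb + ga) x]/(gb x + ga x) gbE gaE /=.
  rewrite [leRHS]ger0_norm ?addr_ge0// /phi.
  by case: ifP => _; [rewrite lerDl|case: ifP => _; rewrite ?lerDr// normr0 addr_ge0].
exists (Lfun_Sub (lee1n 2) laL), (Lfun_Sub (lee1n 2) lbL); split.
- by apply: nearW => x /=; rewrite /la ge_min lexx orbT.
- by apply: nearW => x /=; rewrite /lb oppr_le0 le_max lexx orbT.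
- set phi' : L2 := Lfun_Sub (lee1n 2) phiL.
  rewrite (_ : _ - _ = L2dot vbar phi').
    (* The variational inequality for [w = ubar + phi'], where [w - u k = phi' - (u k - ubar)]. *)
    have vphi k : L2dot (v k) phi' <= r k + L2dot (v k) (u k - ubar).
      have := box_M_dot_le ua ub (u k) (v k) (ubar + phi') (r k) _ (vM k).
      have wab : {ae mu, forall x, ua x <= (ubar + phi') x <= ub x}.
        apply: filterS2 ubP uaP => x /=; rewrite !subr_ge0 => h1 h2.
        rewrite -[X in _ <= X <= _]/(ubar x + phi x) /phi.
        case: ifP => _; first by rewrite addrC subrK (le_trans h2 h1) lexx.
        case: ifP => _; last by rewrite addr0 h2 h1.
        by rewrite addrC subrK (le_trans h2 h1) lexx.
      move=> /(_ wab); rewrite !(L2dotBr, L2dotDr); lra.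
    apply: (ler_cvg_to (vv phi') (_ : (r k + L2dot (v k) (u k - ubar)) @[k --> \oo] --> 0)).
      rewrite -[in X in _ --> X](addr0 0).
      by apply: cvgD; [exact: rr|exact: weak_strong_cvg0 uu vv].
    exact: nearW.
  rewrite -!L2dotNl /L2dot -RintegralD//; [|exact: integrable_L2dot..].
  apply: eq_Rintegral => x _.
  rewrite -[LHS]/(- lb x * (ub x - ubar x) + - la x * (ubar x - ua x)).
  rewrite -[RHS]/(vbar x * phi x) /la /lb /phi.
  (* Only the [lb] term survives where [vbar x > 0], only the [la] term where [vbar x < 0], and
     neither at zero. *)
  by case: (ltgtP (vbar x) 0) => [_|_|->]; ring.
- apply: nearW => x /=; rewrite -[RHS]/(la x - lb x) /la /lb opprK.
  by case: (lerP (vbar x) 0); rewrite ?addr0 ?add0r.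
Qed.

End L2_space.

Theorem mainTheorem10 (R : realType) (d : nat) (Omega : set 'rV[R]_d)
    (oOmega : open Omega) (bOmega : bounded_set Omega)
    (ua ub : L2 (lebesgue_on oOmega))
    (uab : {ae lebesgue_on oOmega, forall x, ua x <= ub x})
    (ubar : L2 (lebesgue_on oOmega)) :
  box_K (box_G ua ub ubar) -> sw_AKKT_regular ua ub ubar.
Proof. exact: box_sw_AKKT_regular. Qed.
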